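(* Let $A$ be a real matrix with $n$ columns, $b$ a real vector, $U$ an $n\times n$ unimodular matrix, $c\in\mathbb{Z}^n$ a row vector, and $$Q=\{x\in\mathbb{R}^n : Ax\le b\},\qquad \tilde Q=\{y\in\mathbb{R}^n : AUy\le b\}.$$ Then 1. $\max\{cx : x\in Q\}=\max\{cUy : y\in\tilde Q\}$, with $x^*$ attaining the maximum in $Q$ if and only if $U^{-1}x^*$ attains it in $\tilde Q$. 2. $\operatorname{width}(c,Q)=\operatorname{width}(cU,\tilde Q)$. 3. $\operatorname{iwidth}(c,Q)=\operatorname{iwidth}(cU,\tilde Q)$.
   Context: A square integral matrix is unimodular if its determinant is $\pm1$. For a polyhedron $Q$ and an integral vector $c$, $$\operatorname{width}(c,Q)=\max\{cx : x\in Q\}-\min\{cx : x\in Q\},$$ $$\operatorname{iwidth}(c,Q)=\lfloor\max\{cx : x\in Q\}\rfloor-\lceil\min\{cx : x\in Q\}\rceil+1.$$ *)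

(* Defs.v *)
From mathcomp Require Import all_boot all_order all_algebra.
From mathcomp Require Import classical_sets reals constructive_ereal.

Set Implicit Arguments.
Unset Strict Implicit.
Unset Printing Implicit Defensive.

Import Order.TTheory GRing.Theory Num.Theory.
Local Open Scope classical_set_scope.
Local Open Scope ring_scope.

Definition unimodular (n : nat) (U : 'M[int]_n) : Prop :=
  \det U = 1 \/ \det U = -1.

Definition int_to_realmx (R : realType) (m n : nat) (M : 'M[int]_(m, n)) :
  'M[R]_(m, n) := map_mx intr M.
Arguments int_to_realmx R {m n} M.

Definition polyhedron (R : realType) (m n : nat) (A : 'M[R]_(m, n))
  (b : 'cV[R]_m) : set 'cV[R]_n :=
  [set x | forall i, (A *m x) i 0 <= b i 0].

Definition lform (R : realType) (n : nat) (c : 'rV[int]_n) (x : 'cV[R]_n) : R :=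
  (int_to_realmx R c *m x) 0 0.

(* The maximum and minimum are relations with values in the extended reals.
   A finite value must be attained; otherwise the usual conventions of linear
   programming apply: over an empty set the maximum is -oo and the minimum is
   +oo, and an unbounded problem has the corresponding infinite value. *)
Definition is_max (R : realType) (S : set R) (M : \bar R) : Prop :=
  match M with
  | EFin r => S r /\ (forall s, S s -> s <= r)
  | +oo%E => forall r, exists2 s, S s & r < s
  | -oo%E => S = set0
  end.

Definition is_min (R : realType) (S : set R) (M : \bar R) : Prop :=
  match M with
  | EFin r => S r /\ (forall s, S s -> r <= s)
  | +oo%E => S = set0
  | -oo%E => forall r, exists2 s, S s & s < r
  end.

Definition attains_max (R : realType) (n : nat) (c : 'rV[int]_n)
  (Q : set 'cV[R]_n) (x : 'cV[R]_n) : Prop :=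
  Q x /\ forall y, Q y -> lform c y <= lform c x.

Definition is_width (R : realType) (n : nat) (c : 'rV[int]_n)
  (Q : set 'cV[R]_n) (w : \bar R) : Prop :=
  exists M m : \bar R, [/\ is_max (lform c @` Q) M, is_min (lform c @` Q) m
    & w = (M - m)%E].

(* Floor and ceiling fix the infinite values; for empty Q the width and the
   integer width are both -oo. *)
Definition is_iwidth (R : realType) (n : nat) (c : 'rV[int]_n)
  (Q : set 'cV[R]_n) (w : \bar int) : Prop :=
  exists M m : \bar R, [/\ is_max (lform c @` Q) M, is_min (lform c @` Q) m
    & w = (er_map Num.floor M - er_map Num.ceil m + 1%:E)%E].

(* Main.v *)
Require Import Defs.
From mathcomp Require Import all_boot all_order all_algebra.
From mathcomp Require Import classical_sets reals constructive_ereal.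

Set Implicit Arguments.
Unset Strict Implicit.
Unset Printing Implicit Defensive.

Import Order.TTheory GRing.Theory Num.Theory.
Local Open Scope classical_set_scope.
Local Open Scope ring_scope.

(** The real matrix [V] of a unimodular [U] is invertible, since its determinant
    is [1] or [-1]; so [x = V y] is a linear change of coordinates, and it
    carries [{y | A V y <= b}] bijectively onto [{x | A x <= b}]
    ([polyhedron_mulmx]) while [c x] equals [(c U) y] ([lform_mulmx]).

    Hence the two programs have literally the same set of objective values
    ([lform_image_unimodular]). Maximum, minimum, width and integer width depend
    on that set alone, so they agree, including when they are infinite or the
    polyhedra are empty; and the maximizers correspond under [y = V^-1 x]. *)

Lemma unimodular_unitmx (R : realType) (n : nat) (U : 'M[int]_n) :
  unimodular U -> int_to_realmx R U \in unitmx.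
Proof.
rewrite unitmxE /int_to_realmx det_map_mx.
by case=> ->; rewrite ?rmorphN rmorph1 ?unitrN unitr1.
Qed.

Lemma polyhedron_mulmx (R : realType) (m n p : nat) (A : 'M[R]_(m, n))
  (V : 'M[R]_(n, p)) (b : 'cV[R]_m) (y : 'cV[R]_p) :
  polyhedron (A *m V) b y <-> polyhedron A b (V *m y).
Proof. by rewrite /polyhedron /= mulmxA. Qed.

Lemma lform_mulmx (R : realType) (n p : nat) (c : 'rV[int]_n)
  (U : 'M[int]_(n, p)) (y : 'cV[R]_p) :
  lform (c *m U) y = lform c (int_to_realmx R U *m y).
Proof. by rewrite /lform /int_to_realmx map_mxM mulmxA. Qed.

(** Every feasible value [c x] is the value at [U^-1 x], which is feasible for
    the transformed program; conversely [(c U) y] is the value at [U y]. *)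
Lemma lform_image_unimodular (R : realType) (m n : nat) (A : 'M[R]_(m, n))
  (b : 'cV[R]_m) (U : 'M[int]_n) (c : 'rV[int]_n) :
  unimodular U ->
  lform c @` polyhedron A b =
  lform (c *m U) @` polyhedron (A *m int_to_realmx R U) b.
Proof.
move=> /(unimodular_unitmx R) uV; apply/seteqP; split=> _ [x Qx <-].
  exists (invmx (int_to_realmx R U) *m x); last by rewrite lform_mulmx mulKVmx.
  by apply/polyhedron_mulmx; rewrite mulKVmx.
exists (int_to_realmx R U *m x); last by rewrite lform_mulmx.
exact/polyhedron_mulmx.
Qed.

(** Being a maximizer means being feasible with a value that bounds the common
    set of objective values, and both conditions are read off the same way at
    [x] and at [U^-1 x]. *)
Lemma attains_max_unimodular (R : realType) (m n : nat) (A : 'M[R]_(m, n))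
  (b : 'cV[R]_m) (U : 'M[int]_n) (c : 'rV[int]_n) (x : 'cV[R]_n) :
  unimodular U ->
  attains_max c (polyhedron A b) x <->
  attains_max (c *m U) (polyhedron (A *m int_to_realmx R U) b)
    (invmx (int_to_realmx R U) *m x).
Proof.
move=> hU; have uV := unimodular_unitmx R hU.
have attainsE d (P : set 'cV[R]_n) z : attains_max d P z <->
    P z /\ forall s, (lform d @` P) s -> s <= lform d z.
  split=> -[Pz maxz]; split=> //; first by move=> _ [y Py <-]; exact: maxz.
  by move=> y Py; apply: maxz; exists y.
have feasE := polyhedron_mulmx A (int_to_realmx R U) b
  (invmx (int_to_realmx R U) *m x).
rewrite mulKVmx // in feasE.
rewrite !attainsE (lform_image_unimodular A b c hU) lform_mulmx mulKVmx //.
by rewrite feasE.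
Qed.

Theorem theorem7 (R : realType) (m n : nat) (A : 'M[R]_(m, n)) (b : 'cV[R]_m)
  (U : 'M[int]_n) (c : 'rV[int]_n) (hU : unimodular U) :
  let Q := polyhedron A b in
  let Qt := polyhedron (A *m int_to_realmx R U) b in
  [/\ (forall M : \bar R,
         is_max (lform c @` Q) M <-> is_max (lform (c *m U) @` Qt) M) /\
      (forall x : 'cV[R]_n,
         attains_max c Q x <->
         attains_max (c *m U) Qt (invmx (int_to_realmx R U) *m x)),
      forall w : \bar R, is_width c Q w <-> is_width (c *m U) Qt w
    & forall w : \bar int, is_iwidth c Q w <-> is_iwidth (c *m U) Qt w].
Proof.
move=> Q Qt; have imE := lform_image_unimodular A b c hU.
split; first split.
- by move=> M; rewrite imE.
- by move=> x; exact: attains_max_unimodular.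
- by move=> w; rewrite /is_width imE.
- by move=> w; rewrite /is_iwidth imE.
Qed.
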